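(* Let $\chi:\mathbb{R}\to\mathbb{R}$ be a kernel, let $f:\mathbb{R}\to\mathbb{R}$ be a bounded, locally integrable function, and let $t\in\mathbb{R}$ be fixed, such that the one-sided limits $f(t+0)$ and $f(t-0)$ exist. Define $$g_t(x):=\begin{cases} f(x)-f(t-0), & x<t,\\ 0, & x=t,\\ f(x)-f(t+0), & x>t.\end{cases}$$ Then for every $w>0$ with $wt\notin\mathbb{Z}$, $$(S_wf)(t)=(S_wg_t)(t)+[f(t+0)-f(t-0)]\cdot\left[\Psi^-_\chi(wt)+\chi(wt-\lfloor wt\rfloor)\right]+f(t-0)-\chi(wt-\lfloor wt\rfloor)\,(wt-\lfloor wt\rfloor)\,[f(t+0)-f(t-0)],$$ while for every $w>0$ with $wt\in\mathbb{Z}$, $$(S_wf)(t)=(S_wg_t)(t)+[f(t+0)-f(t-0)]\cdot\left[\Psi^-_\chi(wt)+\chi(0)\right]+f(t-0).$$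
   Context: A function $\chi:\mathbb{R}\to\mathbb{R}$ is called a kernel if: (1) $\chi\in L^1(\mathbb{R})$ and $\chi$ is bounded on $[-1,1]$; (2) $\sum_{k\in\mathbb{Z}}\chi(u-k)=1$ for every $u\in\mathbb{R}$; (3) for some $\beta>0$, $m_\beta(\chi):=\sup_{u\in\mathbb{R}}\sum_{k\in\mathbb{Z}}|\chi(u-k)|\,|u-k|^\beta<+\infty$. For a kernel $\chi$ and $w>0$, the sampling Kantorovich operator is $(S_wf)(t):=\sum_{k\in\mathbb{Z}}\chi(wt-k)\left[w\int_{k/w}^{(k+1)/w}f(u)\,du\right]$, $t\in\mathbb{R}$, for locally integrable $f:\mathbb{R}\to\mathbb{R}$ such that the series converges for each $t\in\mathbb{R}$ (this holds for bounded measurable $f$). Notation: $f(t\pm0):=\lim_{\varepsilon\to0^+}f(t\pm\varepsilon)$; $\Psi^-_\chi(x):=\sum_{k\in\mathbb{Z},\,k>x}\chi(x-k)$ for $x\in\mathbb{R}$; $\lfloor x\rfloor$ is the largest integer not exceeding $x$. *)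

(* Defs.v *)
From mathcomp Require Import all_boot all_order all_algebra.
From mathcomp Require Import all_classical all_reals all_analysis.

Set Implicit Arguments.
Unset Strict Implicit.
Unset Printing Implicit Defensive.

Import Order.TTheory GRing.Theory Num.Theory.
Import numFieldNormedType.Exports.

Local Open Scope classical_set_scope.
Local Open Scope ring_scope.

(* A series indexed by the integers is split into its terms of index
   n = Posz n >= 0 and its terms of index -(n+1) = Negz n < 0; it converges
   when both halves do.  [zsum] is total: it is the sum of the series only
   when [zsum_cvg] holds. *)
Definition zsum_cvg (R : realType) (a : int -> R) : Prop :=
  cvgn (series (fun n : nat => a (Posz n))) /\
  cvgn (series (fun n : nat => a (Negz n))).

Definition zsum (R : realType) (a : int -> R) : R :=
  limn (series (fun n : nat => a (Posz n))) +
  limn (series (fun n : nat => a (Negz n))).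

(* Lebesgue measure on the sigma-algebra of all Lebesgue-measurable sets:
   [lebesgue_measure] itself lives on the Borel sets only. *)
Notation Leb R := (@completed_lebesgue_measure R).

Definition loc_integrable (R : realType) (f : R -> R) : Prop :=
  forall K : set R, compact K -> (Leb R).-integrable K (EFin \o f).

Definition abs_moment (R : realType) (beta : R) (chi : R -> R) : \bar R :=
  ereal_sup (range (fun u : R =>
    (\esum_(k in [set: int])
       (`|chi (u - k%:~R)| * `|u - k%:~R| `^ beta)%:E)%E)).

Record is_kernel (R : realType) (chi : R -> R) : Prop := {
  kernel_L1 : (Leb R).-integrable setT (EFin \o chi) ;
  kernel_bounded : [bounded chi u | u in `[-1, 1]%classic] ;
  kernel_cvg : forall u : R, zsum_cvg (fun k => chi (u - k%:~R)) ;
  kernel_sum1 : forall u : R, zsum (fun k => chi (u - k%:~R)) = 1 ;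
  kernel_moment : exists2 beta : R, 0 < beta & (abs_moment beta chi < +oo)%E
}.

Definition sampling_kantorovich (R : realType) (chi : R -> R) (w : R)
    (f : R -> R) (t : R) : R :=
  zsum (fun k : int => chi (w * t - k%:~R) *
    (w * Rintegral (Leb R) `[k%:~R / w, (k%:~R + 1) / w]%classic f)).

Definition right_lim (R : realType) (f : R -> R) (t : R) : R :=
  lim (f x @[x --> t^'+]).

Definition left_lim (R : realType) (f : R -> R) (t : R) : R :=
  lim (f x @[x --> t^'-]).

Definition Psi_minus (R : realType) (chi : R -> R) (x : R) : R :=
  zsum (fun k : int => if x < k%:~R then chi (x - k%:~R) else 0).

Definition jump_free_part (R : realType) (f : R -> R) (t : R) (x : R) : R :=
  if x < t then f x - left_lim f t
  else if x == t then 0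
  else f x - right_lim f t.

(* Main.v *)
(* The function f - g_t is constant on each side of t, so w times its mean over
   [k/w, (k+1)/w] is f(t-0) for k < n, f(t+0) for k > n, and the convex combination
   with weights wt - n and 1 - (wt - n) for k = n, where n = floor (wt).  Summing
   against chi (wt - k) gives the formula; wt - n = 0 is the integer case.  The
   rearrangement is legitimate because the moment condition makes the series of
   |chi (wt - k)| converge and the means of f are bounded. *)
Require Import Defs.
From mathcomp Require Import all_boot all_order all_algebra.
From mathcomp Require Import all_classical all_reals all_analysis.
From mathcomp Require Import ring lra.
Import Order.TTheory GRing.Theory Num.Theory.
Import numFieldNormedType.Exports.
Local Open Scope classical_set_scope.
Local Open Scope ring_scope.

(** * Intervals under the completed Lebesgue measure *)

Section completed_intervals.
Context {R : realType}.
Implicit Types (a b t : R) (f : R -> R).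

Lemma completed_measurable_itv (i : interval R) :
  measurable ([set` i] : set (caratheodory_type (@wlength R idfun)^*%mu)).
Proof. by apply: sub_caratheodory; exact: measurable_itv. Qed.

(** The Borel and the completed measure restrict the same outer measure to two sigma-algebras, so
    the Borel computation carries over by conversion. *)
Lemma completed_lebesgue_measure_itv (i : interval R) :
  Leb R [set` i] = (if i.1 < i.2 then (i.2 : \bar R) - i.1 else 0)%E.
Proof. exact: lebesgue_measure_itv. Qed.

Lemma completed_integrable_indic a b (i : interval R) :
  (Leb R).-integrable `[a, b] (EFin \o \1_[set` i]).
Proof.
apply: measurable_bounded_integrable.
- exact: completed_measurable_itv.
- rewrite [ltLHS]completed_lebesgue_measure_itv/=.
  by case: ifPn => // _; rewrite -EFinB ltry.
- by apply: measurable_realfun.measurable_indic; exact: completed_measurable_itv.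
- exists 1; split => // M M1 x _ /=; rewrite indicE.
  by case: (_ \in _); rewrite ?normr0 ?normr1 ltW// (lt_trans _ M1).
Qed.

Lemma Rintegral_indic_itv a b (i : interval R) :
  Rintegral (Leb R) `[a, b] \1_[set` i] =
  fine (Leb R [set` (i `&` `[a, b])%O]).
Proof.
rewrite /Rintegral integral_indic ?set_itvI//; exact: completed_measurable_itv.
Qed.

End completed_intervals.

(** * Integrals and cell means of the jump of [f] at [t] *)

Section jump.
Context {R : realType}.
Implicit Types (a b t : R) (f : R -> R).

(** Truncation at 0 covers the case where the half-line misses the interval, and also an empty
    interval, so no order on [a], [b], [t] is assumed. *)
Lemma Rintegral_indic_lt a b t :
  Rintegral (Leb R) `[a, b] \1_`]-oo, t[ = Num.max 0 (Num.min t b - a).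
Proof.
rewrite Rintegral_indic_itv completed_lebesgue_measure_itv/= meetEtotal lte_fin.
by rewrite -subr_gt0 /Num.max; case: ifPn.
Qed.

Lemma Rintegral_indic_gt a b t :
  Rintegral (Leb R) `[a, b] \1_`]t, +oo[ = Num.max 0 (b - Num.max t a).
Proof.
rewrite Rintegral_indic_itv completed_lebesgue_measure_itv/= joinEtotal lte_fin.
by rewrite -subr_gt0 [in RHS]/Num.max; case: (ltP 0 (b - _)).
Qed.

Lemma Rintegral_indic_pt a b t : Rintegral (Leb R) `[a, b] \1_`[t, t] = 0.
Proof.
rewrite Rintegral_indic_itv completed_lebesgue_measure_itv/= lte_fin ltNge.
by rewrite (le_trans (leIl _ _) (leUl _ _)).
Qed.

(** Indicators turn integrals of the jump into lengths of intervals. The third one restores the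
    value 0 at [t]; it is written with the interval [[t, t]] so that the same interval lemmas apply,
    and it integrates to 0. *)
Lemma jump_free_partE f t : jump_free_part f t =
  (fun x => f x - (left_lim f t * \1_`]-oo, t[ x +
     (right_lim f t * \1_`]t, +oo[ x + f t * \1_`[t, t] x))).
Proof.
apply/funext => x; rewrite /jump_free_part !indicE !mem_setE !in_itv/=.
by case: (ltgtP x t) => [xt|tx|->]; rewrite ?andbT ?andbF/=; ring.
Qed.

Lemma Rintegral_jump_free_part f a b t :
  (Leb R).-integrable `[a, b] (EFin \o f) ->
  Rintegral (Leb R) `[a, b] (jump_free_part f t) =
  Rintegral (Leb R) `[a, b] f - (left_lim f t * Num.max 0 (Num.min t b - a) +
    right_lim f t * Num.max 0 (b - Num.max t a)).
Proof.
move=> fi; rewrite jump_free_partE.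
have mab := completed_measurable_itv `[a, b].
have ci (c : R) (i : interval R) :
    (Leb R).-integrable `[a, b] (EFin \o (fun x => c * \1_[set` i] x)).
  exact: (integrableZl mab c (completed_integrable_indic a b i)).
have ciD (c d : R) (i j : interval R) : (Leb R).-integrable `[a, b]
    (EFin \o (fun x => c * \1_[set` i] x + d * \1_[set` j] x)).
  exact: (integrableD mab (ci c i) (ci d j)).
have ciE (c : R) (i : interval R) :
    Rintegral (Leb R) `[a, b] (fun x => c * \1_[set` i] x) =
    c * Rintegral (Leb R) `[a, b] \1_[set` i].
  exact: (RintegralZl c mab (completed_integrable_indic a b i)).
rewrite (RintegralB mab fi); last exact: (integrableD mab (ci _ _) (ciD _ _ _ _)).
rewrite (RintegralD mab (ci _ _) (ciD _ _ _ _)).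
rewrite (RintegralD mab (ci _ _) (ci _ _)) !ciE.
by rewrite Rintegral_indic_lt Rintegral_indic_gt Rintegral_indic_pt mulr0 addr0.
Qed.

Lemma norm_Rintegral_le_bound f a b (M : R) : a <= b ->
  (Leb R).-integrable `[a, b] (EFin \o f) -> (forall x, `|f x| <= M) ->
  `|Rintegral (Leb R) `[a, b] f| <= M * (b - a).
Proof.
move=> ab fi fM; have mab := completed_measurable_itv `[a, b].
apply: (le_trans (le_normr_Rintegral mab fi)).
have M0 : 0 <= M by exact: le_trans (fM 0).
have cstE : Rintegral (Leb R) `[a, b] (cst M) = M * (b - a).
  rewrite Rintegral_cst// [X in fine X]completed_lebesgue_measure_itv/= lte_fin.
  (* For [a = b] the length formula falls into its default branch 0, which agrees with [b - a]. *)
  move: ab; rewrite le_eqVlt => /predU1P[->|->//].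
  by rewrite ltxx/= subrr.
rewrite -cstE; apply: le_Rintegral => //.
- exact: integrable_norm.
- apply: measurable_bounded_integrable => //.
  rewrite [ltLHS]completed_lebesgue_measure_itv/=.
  by case: ifPn => // _; rewrite -EFinB ltry.
- exact: bounded_cst.
Qed.

(** The factor of [right_lim f t - left_lim f t] is the fraction of the cell lying to the right of
    [t]: 1 if [x < k], [1 - (x - n)] if [k = n], and 0 if [k < n]. *)
Lemma sampling_mean_jump_free_part f t (w : R) (k : int) :
  0 < w -> loc_integrable f ->
  let x := w * t in
  let n := Num.floor x in
  let mean h := w * Rintegral (Leb R) `[k%:~R / w, (k%:~R + 1) / w] h in
  mean f = mean (jump_free_part f t) + (left_lim f t +
    (right_lim f t - left_lim f t) * ((x < k%:~R)%R%:R +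
      (if k == n then 1 - (x - n%:~R) else 0))).
Proof.
move=> w0 floc x n mean; rewrite /mean Rintegral_jump_free_part; last first.
  by apply: floc; exact: segment_compact.
(* Since [w > 0] commutes with min and max, multiplying by [w] rescales the cell to [[k, k + 1]] and
   [t] to [x]. *)
have mulwV (p : R) : w * (p / w) = p by rewrite mulrC divfK// gt_eqF.
have w_max (p q : R) : w * Num.max p q = Num.max (w * p) (w * q).
  by rewrite maxr_pMr// ltW.
have w_min (p q : R) : w * Num.min p q = Num.min (w * p) (w * q).
  by rewrite minr_pMr// ltW.
rewrite mulrBr mulrDr !(mulrCA w) !w_max !mulrBr w_min w_max mulr0 !mulwV -/x.
have /andP[nx xn] : n%:~R <= x < (n + 1)%:~R by exact: floor_itv.
rewrite intrD in xn.
(* The rescaled cell lies left of [x], lies right of [x], or contains [x]; integrality gives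
   [k + 1 <= n] or [n + 1 <= k] in the first two cases. *)
have [kn|nk|->] := ltgtP k n.
- have kx : k%:~R + 1 <= x.
    by rewrite (le_trans _ nx)// -[1]/(1%:~R) -intrD ler_int lezD1.
  rewrite (min_idPr kx) (max_idPl (_ : k%:~R <= x)); last lra.
  rewrite (max_idPr (_ : 0 <= k%:~R + 1 - k%:~R)); last lra.
  rewrite (max_idPl (_ : k%:~R + 1 - x <= 0)) ?ltNge; last lra.
  by rewrite (le_trans _ kx) ?lerDl//=; ring.
- have xk : x < k%:~R.
    by rewrite (lt_le_trans xn)// -[1]/(1%:~R) -intrD ler_int lezD1.
  rewrite (min_idPl (_ : x <= k%:~R + 1)); last lra.
  rewrite (max_idPl (_ : x - k%:~R <= 0)); last lra.
  rewrite (max_idPr (ltW xk)) (max_idPr (_ : 0 <= k%:~R + 1 - k%:~R)); last lra.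
  by rewrite xk/=; ring.
- rewrite (min_idPl (ltW xn)) (max_idPl nx).
  rewrite (max_idPr (_ : 0 <= x - n%:~R)); last lra.
  rewrite (max_idPr (_ : 0 <= n%:~R + 1 - x)); last lra.
  by rewrite ltNge nx/=; ring.
Qed.

End jump.

(** * Series indexed by the integers *)

Lemma zsum_cvgD (R : realType) (a b : int -> R) :
  zsum_cvg a -> zsum_cvg b -> zsum_cvg (fun k => a k + b k).
Proof. by move=> [a1 a2] [b1 b2]; split; exact: is_cvg_seriesD. Qed.

Lemma zsumD (R : realType) (a b : int -> R) :
  zsum_cvg a -> zsum_cvg b ->
  zsum (fun k => a k + b k) = zsum a + zsum b.
Proof.
move=> [a1 a2] [b1 b2]; rewrite /zsum addrACA.
by rewrite -(lim_seriesD a1 b1) -(lim_seriesD a2 b2).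
Qed.

Lemma zsum_cvgZ (R : realType) (c : R) (a : int -> R) :
  zsum_cvg a -> zsum_cvg (fun k => c * a k).
Proof. by move=> [a1 a2]; split; exact: is_cvg_seriesZ. Qed.

Lemma zsumZ (R : realType) (c : R) (a : int -> R) :
  zsum_cvg a -> zsum (fun k => c * a k) = c * zsum a.
Proof.
move=> [a1 a2]; rewrite /zsum mulrDr.
by congr (_ + _); [exact: (lim_seriesZ c a1)|exact: (lim_seriesZ c a2)].
Qed.

Lemma le_zsum_cvg (R : realType) (a b : int -> R) :
  (forall k, `|a k| <= b k) -> zsum_cvg b -> zsum_cvg a.
Proof.
move=> ab [b1 b2]; have b0 k : 0 <= b k by rewrite (le_trans _ (ab k)).
by split; apply: normed_cvg;
  [apply: series_le_cvg b1|apply: series_le_cvg b2] => n /=.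
Qed.

Lemma series_finite_support (R : realType) (u : nat -> R) N :
  (forall n, (N <= n)%N -> u n = 0) -> series u @ \oo --> series u N.
Proof.
move=> u0; apply: cvg_near_cst; exists N => // n /= Nn.
by rewrite -[in LHS](subnK Nn) series_addn big_nat_cond big1 ?addr0//
  => i /andP[/andP[Ni _] _]; exact: u0.
Qed.

Lemma zsum_delta (R : realType) (n : int) (v : R) :
  zsum_cvg (fun k => if k == n then v else 0) /\
  zsum (fun k => if k == n then v else 0) = v.
Proof.
have lim0 : series (fun=> 0 : R) @ \oo --> (0 : R).
  have := @series_finite_support R (fun=> 0) 0 (fun _ _ => erefl).
  by rewrite /series/= big_geq.
have limv (m : nat) : series (fun k : nat => if k == m then v else 0) @ \oo --> v.
  (* [series u N] sums the indices strictly below [N], hence [m.+1] to include the index [m]. *)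
  have := @series_finite_support R (fun k : nat => if k == m then v else 0) m.+1.
  rewrite seriesSr eqxx /series/= big_nat_cond big1 ?add0r.
    by apply => k mk; rewrite gtn_eqF.
  by move=> i /andP[/andP[_ im] _]; rewrite ltn_eqF.
(* Equality on [int] computes on constructors, so one half is [limv] and the
   other one is [lim0] up to conversion. *)
case: n => m; split.
- by split; [exact: cvgP (limv m)|exact: cvgP lim0].
- by rewrite -[RHS]addr0; congr (_ + _); apply: cvg_lim => //; exact: limv.
- by split; [exact: cvgP lim0|exact: cvgP (limv m)].
- by rewrite -[RHS]add0r; congr (_ + _); apply: cvg_lim => //; exact: limv.
Qed.

(** Passes from the unordered sum of [abs_moment] to the two halves of [zsum_cvg]: each half is a
    sum over an injective image of the naturals, whose finite subsets are among those of the
    integers. *)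
Lemma esum_zsum_cvg (R : realType) (a : int -> R) :
  (forall k, 0 <= a k) -> (\esum_(k in [set: int]) (a k)%:E < +oo)%E ->
  zsum_cvg a.
Proof.
move=> a0 aoo.
have half (e : nat -> int) : injective e -> cvgn (series (a \o e)).
  move=> e_inj; apply: nnseries_is_cvg => [n|]; first exact: a0.
  rewrite nneseries_esumT => [|n]; last by rewrite lee_fin a0.
  rewrite -(esum_image setT e (fun k => (a k)%:E)); last by move=> x y _ _ /e_inj.
  apply: le_lt_trans aoo; apply: ge_ereal_sup => _ [X [finX _] <-].
  by apply: ereal_sup_ubound; exists X.
by split; apply: half => m n; case.
Qed.

(* Where [1 <= |x - k|] the moment dominates [|chi (x - k)|]; only finitely many
   [k] remain. *)
Lemma kernel_abs_cvg (R : realType) (chi : R -> R) (x : R) :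
  is_kernel chi -> zsum_cvg (fun k => `|chi (x - k%:~R)|).
Proof.
move=> /kernel_moment[beta beta0 moment].
pose far (k : int) := `|chi (x - k%:~R)| * `|x - k%:~R| `^ beta.
pose near (k : int) := if `|x - k%:~R| < 1 then `|chi (x - k%:~R)| else 0.
have far0 k : 0 <= far k by rewrite mulr_ge0// powR_ge0.
have near0 k : 0 <= near k by rewrite /near; case: ifP.
have far_cvg : zsum_cvg far.
  apply: esum_zsum_cvg => //; apply: le_lt_trans moment.
  by apply: ereal_sup_ubound; exists x.
(* For [|k| >= N] one has [|x - k| >= |k| - |x| >= 1], so [near k] vanishes. *)
pose N := (Num.bound `|x|).+1.
have xN : `|x| + 1 <= N%:R.
  by rewrite /N -natr1 lerD2r ltW// archi_boundP.
have near_cvg : zsum_cvg near.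
  have near_out k : N%:R <= `|k%:~R : R| -> near k = 0.
    move=> Nk; rewrite /near ltNge; case: ifPn => //.
    have := lerB_dist (k%:~R : R) x; rewrite (distrC _ x).
    move=> h1; rewrite (le_trans _ h1)//; lra.
  split; apply: cvgP; apply: (@series_finite_support _ _ N) => n Nn;
    apply: near_out.
  - by rewrite -pmulrn normr_nat ler_nat.
  - by rewrite NegzE mulrNz normrN -pmulrn normr_nat ler_nat (leq_trans Nn).
apply: le_zsum_cvg (zsum_cvgD _ _ _ far_cvg near_cvg) => k /=.
rewrite normr_id; case: (ltP `|x - k%:~R| 1) => [lt1|ge1].
  by rewrite /near lt1 lerDr.
rewrite (@le_trans _ _ (far k)) ?lerDl// -[leLHS]mulr1 ler_wpM2l//.
(* The factor 1 is read as the power of exponent 0; powers of a base at least 1 increase with the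
   exponent. *)
by rewrite -[leLHS](powRr0 `|x - k%:~R|) ler_powR// ltW.
Qed.

(** * Summation of the cell means against the kernel *)

Lemma sampling_kantorovich_jump (R : realType) (chi f : R -> R) (t w : R) :
  is_kernel chi -> [bounded f x | x in [set: R]] -> loc_integrable f -> 0 < w ->
  let x := w * t in
  let d := x - (Num.floor x)%:~R in
  sampling_kantorovich chi w f t =
    sampling_kantorovich chi w (jump_free_part f t) t
    + (right_lim f t - left_lim f t) * (Psi_minus chi x + chi d * (1 - d))
    + left_lim f t.
Proof.
move=> hchi [M0 [_ fM0]] floc w0 x d.
(* Boundedness provides every bound strictly above [M0]; [M0 + 1] is one of them. *)
have fM y : `|f y| <= M0 + 1 by apply: fM0 => //; rewrite ltrDl.
set L := left_lim f t; set J := right_lim f t - L; set M := M0 + 1 in fM *.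
pose mean (h : R -> R) (k : int) :=
  w * Rintegral (Leb R) `[k%:~R / w, (k%:~R + 1) / w] h.
pose n := Num.floor x.
pose psi (k : int) := if x < k%:~R then chi (x - k%:~R) else 0.
pose delta (k : int) := if k == n then chi d * (1 - d) else 0.
have mean_le k : `|mean f k| <= M.
  have ab : k%:~R / w <= (k%:~R + 1) / w by rewrite ler_pM2r ?invr_gt0// lerDl.
  have fi := floc _ (@segment_compact _ (k%:~R / w) ((k%:~R + 1) / w)).
  rewrite normrM gtr0_norm//.
  rewrite (le_trans (ler_wpM2l (ltW w0)
    (norm_Rintegral_le_bound _ _ _ _ ab fi fM)))//.
  by rewrite -mulrBl addrAC subrr add0r mul1r mulrCA divff ?mulr1// gt_eqF.
have chi_abs := kernel_abs_cvg _ _ x hchi.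
have f_cvg : zsum_cvg (fun k => chi (x - k%:~R) * mean f k).
  apply: le_zsum_cvg (zsum_cvgZ _ M _ chi_abs) => k.
  by rewrite normrM mulrC ler_wpM2r.
have psi_cvg : zsum_cvg psi.
  by apply: le_zsum_cvg chi_abs => k; rewrite /psi; case: ifP; rewrite ?normr0.
have [delta_cvg deltaE] := zsum_delta R n (chi d * (1 - d)).
have chi_cvg := kernel_cvg hchi x.
have JD_cvg := zsum_cvgZ _ J _ (zsum_cvgD _ _ _ psi_cvg delta_cvg).
have split_mean k : chi (x - k%:~R) * mean f k =
    chi (x - k%:~R) * mean (jump_free_part f t) k +
    (J * (psi k + delta k) + L * chi (x - k%:~R)).
  have := sampling_mean_jump_free_part f t w k w0 floc.
  rewrite /= -!/(mean _ k) -/x -/n -/L -/J => ->; rewrite /psi /delta.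
  (* At [k = n] the term [psi] is 0 because [n <= x], so [delta] alone carries the cell containing
     [t], also when [x] is an integer. *)
  case: (eqVneq k n) => [->|_]; last by case: ifP => _ /=; ring.
  by rewrite ltNge floor_le /= -/d; ring.
have jump_cvg := zsum_cvgD _ _ _ JD_cvg (zsum_cvgZ _ L _ chi_cvg).
(* Additivity of [zsum] requires convergence of both summands; this one is the difference of two
   convergent series. *)
have g_cvg : zsum_cvg (fun k => chi (x - k%:~R) * mean (jump_free_part f t) k).
  have := zsum_cvgD _ _ _ f_cvg (zsum_cvgZ _ (-1) _ jump_cvg).
  congr zsum_cvg; apply/funext => k; rewrite split_mean -/(delta k); ring.
have -> : sampling_kantorovich chi w f t =
    zsum (fun k => chi (x - k%:~R) * mean (jump_free_part f t) k +
      (J * (psi k + delta k) + L * chi (x - k%:~R))).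
  by congr zsum; apply/funext.
rewrite (zsumD _ _ _ g_cvg jump_cvg).
rewrite (zsumD _ _ _ JD_cvg (zsum_cvgZ _ L _ chi_cvg)).
rewrite (zsumZ _ J _ (zsum_cvgD _ _ _ psi_cvg delta_cvg)).
rewrite (zsumD _ _ _ psi_cvg delta_cvg) deltaE.
by rewrite (zsumZ _ L _ chi_cvg) (kernel_sum1 hchi) mulr1 addrA.
Qed.

Theorem lemma2p5 (R : realType) (chi f : R -> R) (t : R)
    (hchi : is_kernel chi)
    (fbounded : [bounded f x | x in [set: R]])
    (flocint : loc_integrable f)
    (fright : cvg (f x @[x --> t^'+]))
    (fleft : cvg (f x @[x --> t^'-])) :
  (forall w : R, 0 < w -> w * t \isn't a Num.int ->
     sampling_kantorovich chi w f t =
       sampling_kantorovich chi w (jump_free_part f t) t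
       + (right_lim f t - left_lim f t)
         * (Psi_minus chi (w * t) + chi (w * t - (Num.floor (w * t))%:~R))
       + left_lim f t
       - chi (w * t - (Num.floor (w * t))%:~R)
         * (w * t - (Num.floor (w * t))%:~R)
         * (right_lim f t - left_lim f t))
  /\
  (forall w : R, 0 < w -> w * t \is a Num.int ->
     sampling_kantorovich chi w f t =
       sampling_kantorovich chi w (jump_free_part f t) t
       + (right_lim f t - left_lim f t) * (Psi_minus chi (w * t) + chi 0)
       + left_lim f t).
Proof.
(* One formula serves both cases: expanding [chi d * (1 - d)] gives the first, and [d = 0] at an
   integer gives the second. *)
split => w w0 wt; rewrite sampling_kantorovich_jump//; first by ring.
move: wt; rewrite intrEfloor => /eqP ->.
by rewrite subrr subr0 mulr1.
Qed.
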